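(* For every integer $n$ with $n \geq 4$, the Boolean lattice $\mathcal{B}_n$ of order $n$ satisfies $$\operatorname{ldim}(\mathcal{B}_n) < n.$$
   Context: A poset is a pair $P=(X,\leq)$ where $X$ is a non-empty set and $\leq$ is a reflexive, antisymmetric, transitive relation on $X$. A poset $Q$ is a subposet of $P$ if the ground set of $Q$ is a subset of that of $P$ and the order of $Q$ is the restriction of the order of $P$. A linear extension of $P$ is a linear order $L$ on the ground set of $P$ such that $x\leq_L y$ whenever $x\leq_P y$. A partial linear extension of $P$ is a linear extension of a subposet of $P$. A local realizer of $P$ is a family $\mathcal{L}$ of partial linear extensions of $P$ such that for all $x,y\in P$ there exists $L\in\mathcal{L}$ with $x,y\in L$, and $x\leq_P y$ if and only if there is no $L\in\mathcal{L}$ with $y<_L x$. The frequency of an element $x\in P$ in $\mathcal{L}$ is the number of $L\in\mathcal{L}$ with $x\in L$ (i.e. $x$ is in the ground set of $L$); the frequency of $\mathcal{L}$ is the maximum frequency of an element of $P$ in $\mathcal{L}$. The local dimension $\operatorname{ldim}(P)$ is the minimum frequency of a local realizer of $P$. For a positive integer $n$, the Boolean lattice $\mathcal{B}_n$ is the poset of all subsets of $[n]=\{1,\dots,n\}$ ordered by inclusion. *)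

(* Defs.v *)
From HB Require Import structures.
From mathcomp Require Import all_boot all_order.

Set Implicit Arguments.
Unset Strict Implicit.
Unset Printing Implicit Defensive.
Import Order.TTheory.
Local Open Scope order_scope.

(* r, as a set of pairs (x, y) with x below y, is a linear order on A.
   Since r is contained in A x A, a linear order on A is a single set r. *)
Definition linear_order_on (T : finType) (A : {set T}) (r : {set T * T}) :
    bool :=
  [&& r \subset setX A A,
      [forall x in A, (x, x) \in r],
      [forall x, forall y, ((x, y) \in r) && ((y, x) \in r) ==> (x == y)],
      [forall x, forall y, forall z,
         ((x, y) \in r) && ((y, z) \in r) ==> ((x, z) \in r)] &
      [forall x in A, forall y in A, ((x, y) \in r) || ((y, x) \in r)]].

(* L.1 is the ground set of the subposet and L.2 the order of the extension. *)
Definition is_ple (d : Order.disp_t) (T : finPOrderType d)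
    (L : {set T} * {set T * T}) : bool :=
  [&& L.1 != set0, linear_order_on L.1 L.2 &
      [forall x in L.1, forall y in L.1, (x <= y) ==> ((x, y) \in L.2)]].

Record ple (d : Order.disp_t) (T : finPOrderType d) := Ple {
  ple_val :> {set T} * {set T * T};
  _ : is_ple ple_val
}.

HB.instance Definition _ (d : Order.disp_t) (T : finPOrderType d) :=
  [isSub for @ple_val d T].
HB.instance Definition _ (d : Order.disp_t) (T : finPOrderType d) :=
  [Finite of ple T by <:].

Definition ground (d : Order.disp_t) (T : finPOrderType d) (L : ple T) :
  {set T} := L.1.

Definition ple_lt (d : Order.disp_t) (T : finPOrderType d) (L : ple T)
  (x y : T) : bool := ((x, y) \in L.2) && (x != y).

(* A finite poset has finitely many partial linear extensions, so {set ple T}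
   contains every set of them; repeating members would only raise
   frequencies. *)
Definition local_realizer (d : Order.disp_t) (T : finPOrderType d)
    (F : {set ple T}) : bool :=
  [forall x, forall y,
     [exists L in F, (x \in ground L) && (y \in ground L)] &&
     ((x <= y) == ~~ [exists L in F, ple_lt L y x])].

Definition elt_frequency (d : Order.disp_t) (T : finPOrderType d)
  (F : {set ple T}) (x : T) : nat := #|[set L in F | x \in ground L]|.

Definition frequency (d : Order.disp_t) (T : finPOrderType d)
  (F : {set ple T}) : nat := (\max_(x : T) elt_frequency F x)%N.

Lemma pair_is_ple (d : Order.disp_t) (T : finPOrderType d) (a b : T) :
  (b <= a) ==> (a == b) ->
  is_ple ([set a; b], [set (a, a); (b, b); (a, b)]).
Proof.
move=> hab; apply/and3P; split=> /=.
- by apply/set0Pn; exists a; rewrite !inE eqxx.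
- apply/and5P; split.
  + apply/subsetP=> -[x y]; rewrite !inE !xpair_eqE.
    by case: (x =P a); case: (x =P b); case: (y =P a); case: (y =P b).
  + apply/forall_inP=> x; rewrite !inE !xpair_eqE.
    by case: (x =P a); case: (x =P b).
  + apply/forallP=> x; apply/forallP=> y; apply/implyP.
    rewrite !inE !xpair_eqE.
    move=> h; apply/eqP; move: h.
    by case: (x =P a); case: (x =P b); case: (y =P a); case: (y =P b) => //=;
      congruence.
  + apply/forallP=> x; apply/forallP=> y; apply/forallP=> z; apply/implyP.
    rewrite !inE !xpair_eqE.
    by case: (x =P a); case: (x =P b); case: (y =P a); case: (y =P b);
      case: (z =P a); case: (z =P b) => //=; congruence.
  + apply/forall_inP=> x; rewrite !inE => hx.
    apply/forall_inP=> y; rewrite !inE => hy.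
    by case/orP: hx => /eqP->; case/orP: hy => /eqP->;
      rewrite ?xpair_eqE !eqxx ?orbT.
- apply/forall_inP=> x; rewrite !inE => hx.
  apply/forall_inP=> y; rewrite !inE => hy; apply/implyP.
  case/orP: hx => /eqP->; case/orP: hy => /eqP->; rewrite ?eqxx ?orbT //.
  by move=> hba; rewrite hba /= in hab; rewrite (eqP hab) !eqxx.
Qed.

Lemma local_realizerT (d : Order.disp_t) (T : finPOrderType d) :
  local_realizer [set: ple T].
Proof.
apply/forallP=> x; apply/forallP=> y.
have [lexy|nlexy] := boolP (x <= y); last first.
  have h : is_ple ([set y; x], [set (y, y); (x, x); (y, x)]).
    by apply: pair_is_ple; rewrite (negbTE nlexy).
  apply/andP; split.
    by apply/exists_inP; exists (Ple h); rewrite ?inE // !eqxx ?orbT.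
  apply/eqP/esym/negbF/exists_inP; exists (Ple h); rewrite ?inE //.
  rewrite /ple_lt /= !inE eqxx ?orbT /=.
  by apply: contraNneq nlexy => ->.
apply/andP; split.
  have h : is_ple ([set x; y], [set (x, x); (y, y); (x, y)]).
    apply: pair_is_ple; apply/implyP => leyx.
    by apply/eqP/le_anti; rewrite lexy.
  by apply/exists_inP; exists (Ple h); rewrite ?inE // !eqxx ?orbT.
rewrite eq_sym eqb_id; apply/exists_inP=> -[[L /= hL] _].
rewrite /ple_lt /= => /andP[hyx nyx].
have /and3P[_ /and5P[/subsetP sL _ /forallP anti _ _] /forall_inP ext] := hL.
have /setXP[hy hx] := sL _ hyx.
have hxy := implyP (forall_inP (ext x hx) y hy) lexy.
by have /forallP/(_ x)/implyP := anti y; rewrite hyx hxy (negbTE nyx) => /(_ isT).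
Qed.

Lemma local_realizer_ex (d : Order.disp_t) (T : finPOrderType d) :
  exists k : nat, [exists F : {set ple T},
    local_realizer F && (frequency F == k)].
Proof.
exists (frequency [set: ple T]); apply/existsP; exists [set: ple T].
by rewrite local_realizerT eqxx.
Qed.

Definition ldim (d : Order.disp_t) (T : finPOrderType d) : nat :=
  ex_minn (local_realizer_ex T).

(* Makes inclusion the canonical order on {set T}. *)
Import Order.DefaultSetSubsetOrder.

(* The base set [n] is rendered as 'I_n = {0, ..., n-1}. *)
Definition boolean_lattice (n : nat) :
  finPOrderType Order.SetSubsetOrder.subset_display := {set 'I_n}.

Lemma le_boolean_lattice (n : nat) (A B : boolean_lattice n) :
  (A <= B) = ((A : {set 'I_n}) \subset (B : {set 'I_n})).
Proof. by []. Qed.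

(* Main.v *)
Require Import Defs.
From mathcomp Require Import all_boot all_order.
From mathcomp Require Import zify.

Set Implicit Arguments.
Unset Strict Implicit.
Unset Printing Implicit Defensive.
Import Order.TTheory.

(** Passing from $B_n$ to $B_(n+1)$ raises the local dimension by at most one,
    so a local realizer of $B_4$ of frequency 3 settles every n >= 4.

    For the step, $B_(n+1)$ is the product of $B_n$ with a two-element chain.
    In each member of a local realizer of $B_n$ replace every element by its
    two copies, lower copy first.  This reverses all the pairs (b, x), (c, y)
    with x not below y.  What is left are the pairs with x < y whose first
    coordinates are in the wrong order, and one linear extension of the whole
    product, with all the lower copies under all the upper ones, reverses them
    at once (list_realizer_double).

    For $B_4$, recall that the usual realizer has one linear extension for
    each point i, in which the sets containing i come after those that do not:
    a set x not included in y is then above y in the extension of any i in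
    x \ y.  Four lists of this shape are used, but each set is removed from
    one of them, which brings the frequency down to 3.  The set {i} and its
    complement must both stay in list i, since no other list can reverse them.
    When x \ y = {i} and x or y was removed from list i, the order among the
    sets that contain a given point, or among those that do not, has to place
    y before x in another list; B4_lists is chosen so that this always
    happens.

    Partial linear extensions are handled as lists of elements in increasing
    order (list_realizer), which can be computed with. *)

(** * Local realizers as families of lists *)

Section ListRealizers.
Variables (d : Order.disp_t) (T : finPOrderType d).
Implicit Types (x y : T) (s t : seq T) (ls : seq (seq T)).

Definition precedes s x y : bool :=
  [&& x \in s, y \in s & index x s <= index y s].

Lemma precedes_anti s x y : precedes s x y -> precedes s y x -> x = y.
Proof.
case/and3P=> xs ys le_xy /and3P[_ _ le_yx].
have eq_i : index x s = index y s by apply/eqP; rewrite eqn_leq le_xy.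
by rewrite -(nth_index x xs) eq_i nth_index.
Qed.

(** A list may repeat elements: only first occurrences matter, as positions
    are read by [index]. *)
Definition extends_order s : Prop :=
  forall x y, x \in s -> y \in s -> (x <= y)%O -> index x s <= index y s.

(** The second clause packs the two requirements on a local realizer into one.
    For x and y incomparable it asks for a reversal; for y <= x it only asks
    for a list containing both, since the first clause then puts them in
    order. *)
Definition list_realizer k ls : Prop :=
  [/\ forall s, s \in ls -> extends_order s,
      forall x y, ~~ (x < y)%O -> has (fun s => precedes s y x) ls
    & forall x, count (fun s => x \in s) ls <= k].

Definition ple_of_seq s : {set T} * {set T * T} :=
  ([set x in s], [set p | precedes s p.1 p.2]).

Lemma ple_of_seqP s x : extends_order s -> x \in s -> is_ple (ple_of_seq s).
Proof.
move=> ext xs; apply/and3P; split=> /=.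
- by apply/set0Pn; exists x; rewrite inE.
- apply/and5P; split.
  + by apply/subsetP=> -[y z]; rewrite !inE => /and3P[-> ->].
  + by apply/forall_inP=> y; rewrite !inE /precedes /= leqnn => ->.
  + apply/forallP=> y; apply/forallP=> z; rewrite !inE /=.
    by apply/implyP=> /andP[yz zy]; apply/eqP/(precedes_anti yz).
  + apply/forallP=> y; apply/forallP=> z; apply/forallP=> w.
    rewrite !inE /precedes /=; apply/implyP.
    by case/andP=> /and3P[-> _ le1] /and3P[_ -> le2] /=; lia.
  + apply/forall_inP=> y; rewrite !inE => ys.
    apply/forall_inP=> z; rewrite !inE => zs.
    by rewrite /precedes /= ys zs /= leq_total.
- apply/forall_inP=> y; rewrite !inE => ys.
  apply/forall_inP=> z; rewrite !inE => zs; apply/implyP=> le_yz.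
  by rewrite /precedes /= ys zs ext.
Qed.

Lemma ldim_list_realizer k ls : list_realizer k ls -> ldim T <= k.
Proof.
case=> ext cov freq.
pose F := [set L : ple T | val L \in [seq ple_of_seq s | s <- ls]].
have inF x y : ~~ (x < y)%O ->
    exists2 L, L \in F & [&& x \in ground L, y \in ground L & (y, x) \in L.2].
  case/cov/hasP=> s sls yx; have /and3P[ys xs _] := yx.
  exists (Ple (ple_of_seqP (ext s sls) xs)); last by rewrite !inE xs ys.
  by rewrite inE; apply: (map_f ple_of_seq).
suff [real le_k] : local_realizer F /\ frequency F <= k.
  rewrite /ldim; case: ex_minnP => m _ min; apply: leq_trans le_k.
  by apply: min; apply/existsP; exists F; rewrite real eqxx.
split.
  apply/forallP=> x; apply/forallP=> y; apply/andP; split.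
    have [lt_xy|/inF[L LF /and3P[xL yL _]]] := boolP (x < y)%O; last first.
      by apply/exists_inP; exists L => //; rewrite xL.
    have /inF[L LF /and3P[yL xL _]] : ~~ (y < x)%O by rewrite lt_gtF.
    by apply/exists_inP; exists L => //; rewrite xL.
  have [le_xy|nle_xy] := boolP (x <= y)%O.
    apply/eqP/esym/exists_inP => -[L]; rewrite inE => /mapP[s sls valL].
    rewrite /ple_lt [X in X.2]valL inE => /andP[/= yx /eqP[]].
    have /and3P[ys xs _] := yx; apply: (precedes_anti yx).
    by rewrite /precedes xs ys (ext s).
  apply/eqP/esym/negbF/exists_inP.
  have /inF[L LF /and3P[_ _ yxL]] : ~~ (x < y)%O.
    by apply: contra nle_xy => /ltW.
  exists L => //; rewrite /ple_lt yxL.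
  by apply: contraNneq nle_xy => ->.
apply/bigmax_leqP=> x _; apply: leq_trans (freq x).
rewrite /elt_frequency -(card_imset _ val_inj) -size_filter.
rewrite -(size_map ple_of_seq); apply: leq_trans (card_size _).
apply/subset_leq_card/subsetP=> _ /imsetP[L LFx ->].
move: LFx; rewrite !inE => /andP[/mapP[s sls valL]].
rewrite /ground valL inE => xs.
by rewrite valL; apply: map_f; rewrite mem_filter xs.
Qed.

(** Sorting by the number of elements below works because this number is
    strictly monotone. *)
Lemma linear_extension_seq : exists2 t, extends_order t & forall x, x \in t.
Proof.
pose rank x := #|[set z | (z < x)%O]|.
pose le_rank x y := rank x <= rank y.
exists (sort le_rank (enum T)) => [x y xt yt le_xy|x]; last first.
  by rewrite mem_sort mem_enum.
have [->//|neq_xy] := eqVneq x y.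
rewrite leqNgt; apply/negP=> lt_yx.
have: le_rank y x.
  have le_trans_rank : transitive le_rank by move=> ? ? ?; apply: leq_trans.
  have le_total_rank : total le_rank by move=> ? ?; apply: leq_total.
  exact: (sorted_ltn_index le_trans_rank (sort_sorted le_total_rank _) _ _ yt xt).
apply/negP; rewrite -ltnNge; apply/proper_card/properP; split.
  by apply/subsetP=> z; rewrite !inE => /lt_le_trans; apply.
by exists x; rewrite !inE ?ltxx // lt_neqAle neq_xy.
Qed.

End ListRealizers.

(** * Product with a two-element chain *)

Section Doubling.
Variables (d d' : Order.disp_t) (T : finPOrderType d) (T' : finPOrderType d').
(* The hypotheses say that f identifies T' with the product of the chain
   false < true and T; they spare a transport along an isomorphism. *)
Variable f : bool -> T -> T'.
Hypothesis f_surj : forall z, exists b x, z = f b x.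
Hypothesis f_le : forall b c x y, (f b x <= f c y)%O = (b ==> c) && (x <= y)%O.

Let f_eq b c x y : (f b x == f c y) = (b == c) && (x == y).
Proof.
by rewrite !eq_le !f_le; case: b c => [] [] //=; rewrite ?andbF.
Qed.

Let f_inj b : injective (f b).
Proof. by move=> x y /eqP; rewrite f_eq eqxx => /eqP. Qed.

Fixpoint double (s : seq T) : seq T' :=
  if s is x :: s' then [:: f false x, f true x & double s'] else [::].

Lemma mem_double b x s : (f b x \in double s) = (x \in s).
Proof.
elim: s => //= y s IHs; rewrite !inE IHs !f_eq.
by case: b {IHs}; case: (x == y).
Qed.

Lemma index_double b x s : index (f b x) (double s) = (index x s).*2 + b * (x \in s).
Proof.
elim: s => [|y s IHs] /=; first by rewrite muln0.
rewrite !f_eq IHs inE (eq_sym x y).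
by case: b {IHs}; case: (y == x) => //=; rewrite !addSn doubleS.
Qed.

Definition stack (t : seq T) : seq T' := map (f false) t ++ map (f true) t.

Lemma mem_stack b x t : (f b x \in stack t) = (x \in t).
Proof.
have notin c : f (~~ c) x \in map (f c) t = false.
  by apply/mapP => -[y _ /eqP]; rewrite f_eq; case: c.
by rewrite mem_cat; case: b; rewrite ?(notin false) ?(notin true) ?orbF mem_map.
Qed.

Lemma index_stack b x t : x \in t -> index (f b x) (stack t) = index x t + b * size t.
Proof.
move=> xt; rewrite index_cat size_map; case: b.
  rewrite index_map //; case: mapP => [[y _ /eqP]|_]; first by rewrite f_eq.
  by rewrite mul1n addnC.
by rewrite map_f // index_map // addn0.
Qed.

(** The extra list [stack t] contains every element, hence the cost of one. *)
Lemma list_realizer_double k (ls : seq (seq T)) : list_realizer k ls ->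
  exists ls' : seq (seq T'), list_realizer k.+1 ls'.
Proof.
case=> ext cov freq; have [t t_ext t_full] := linear_extension_seq T.
exists (stack t :: map double ls); split.
- move=> s'; rewrite inE => /predU1P[->|/mapP[s sls ->]] z w.
    have [b [x ->]] := f_surj z; have [c [y ->]] := f_surj w.
    move=> _ _; rewrite f_le !index_stack // => /andP[le_bc le_xy].
    have := t_ext x y (t_full x) (t_full y) le_xy.
    by case: b c le_bc => [] []; lia.
  have [b [x ->]] := f_surj z; have [c [y ->]] := f_surj w.
  rewrite !mem_double !index_double f_le => xs ys /andP[le_bc le_xy].
  rewrite xs ys; have := ext s sls x y xs ys le_xy.
  by case: b c le_bc => [] []; lia.
- move=> z w; have [b [x ->]] := f_surj z; have [c [y ->]] := f_surj w.
  rewrite lt_neqAle f_eq f_le => nlt /=.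
  have [lt_xy|nlt_xy] := boolP (x < y)%O.
    have [-> ->] : b = true /\ c = false.
      move: nlt; rewrite (ltW lt_xy) (lt_eqF lt_xy) andbF.
      by case: b c => [] [].
    (* The only pairs the doubled lists cannot reverse. *)
    apply/orP; left; rewrite /precedes !mem_stack !t_full !index_stack //=.
    by rewrite mul1n addn0 (leq_trans (index_size _ _)) ?leq_addl.
  apply/orP; right; have /hasP[s sls /and3P[ys xs le_yx]] := cov x y nlt_xy.
  apply/hasP; exists (double s); first exact: map_f.
  rewrite /precedes !mem_double !index_double xs ys /=.
  have [eq_xy|neq_xy] := eqVneq x y.
    by move: nlt; rewrite eq_xy lexx eqxx; case: b c => [] []; lia.
  have lt_yx : index y s < index x s.
    rewrite ltn_neqAle le_yx andbT; apply: contra neq_xy => /eqP eq_i.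
    by rewrite -(nth_index x xs) -eq_i nth_index.
  by move: b c {nlt} => [] []; lia.
move=> z; have [b [x ->]] := f_surj z.
rewrite /= mem_stack t_full add1n ltnS count_map.
by rewrite (eq_count (a2 := fun s => x \in s)) // => s /=; rewrite mem_double.
Qed.

End Doubling.

(** The last point plays the role of the chain: a subset of [n+1] is a subset
    of [n] together with the bit telling whether it contains that point. *)
Lemma list_realizer_boolean_latticeS n k
    (ls : seq (seq (boolean_lattice n))) :
  list_realizer k ls ->
  exists ls' : seq (seq (boolean_lattice n.+1)), list_realizer k.+1 ls'.
Proof.
pose f b (A : boolean_lattice n) : boolean_lattice n.+1 :=
  [set i | if unlift ord_max i is Some j then j \in A else b].
apply: (@list_realizer_double _ _ _ _ f) => [B|b c A B].
  exists (ord_max \in B), [set j | lift ord_max j \in B].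
  by apply/setP=> i; rewrite inE; case: unliftP => [j|] ->; rewrite ?inE.
rewrite !le_boolean_lattice; apply/subsetP/andP=> [sub|[le_bc /subsetP sub] i].
  split.
    by have := sub ord_max; rewrite !inE unlift_none => bc; apply/implyP.
  by apply/subsetP=> j; have := sub (lift ord_max j); rewrite !inE liftK.
by rewrite !inE; case: unlift => [j|]; [apply: sub | apply/implyP].
Qed.

(** * The Boolean lattice of order four *)

(** The i-th list is cut in two: first sets avoiding i, then sets containing
    i.  The first list leaves out {3}, {3,4}, {1,2,3}, {1,3,4}; the second {4},
    {1,4}, {2,4}, {2,3,4}; the third {1}, {1,2}, {1,3}; the fourth {2}, {2,3},
    {1,2,4} and the two extreme sets. *)
Definition B4_lists : seq (seq (seq nat)) :=
  [:: [:: [::]; [:: 2]; [:: 2; 3]; [:: 4]; [:: 2; 4]; [:: 2; 3; 4];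
          [:: 1]; [:: 1; 4]; [:: 1; 2]; [:: 1; 2; 4]; [:: 1; 3];
          [:: 1; 2; 3; 4]];
      [:: [::]; [:: 3]; [:: 3; 4]; [:: 1]; [:: 1; 3]; [:: 1; 3; 4];
          [:: 2]; [:: 1; 2]; [:: 2; 3]; [:: 1; 2; 3]; [:: 1; 2; 4];
          [:: 1; 2; 3; 4]];
      [:: [::]; [:: 4]; [:: 1; 4]; [:: 2]; [:: 2; 4]; [:: 1; 2; 4];
          [:: 3]; [:: 2; 3]; [:: 3; 4]; [:: 2; 3; 4]; [:: 1; 3; 4];
          [:: 1; 2; 3]; [:: 1; 2; 3; 4]];
      [:: [:: 1]; [:: 1; 2]; [:: 3]; [:: 1; 3]; [:: 1; 2; 3];
          [:: 4]; [:: 3; 4]; [:: 1; 4]; [:: 1; 3; 4]; [:: 2; 4];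
          [:: 2; 3; 4]]].

(** Labels run from 1 to 4 and ordinals from 0 to 3. *)
Definition set_of_labels (c : seq nat) : boolean_lattice 4 :=
  [set i : 'I_4 | i.+1 \in c].

Definition bits_of_labels (c : seq nat) : bool * bool * bool * bool :=
  (1 \in c, 2 \in c, 3 \in c, 4 \in c).

(** Finite sets do not reduce to normal forms, whereas inclusion, membership
    and positions do on quadruples of booleans. *)
Definition bits (A : boolean_lattice 4) : bool * bool * bool * bool :=
  (inord 0 \in A, inord 1 \in A, inord 2 \in A, inord 3 \in A).

Definition bits_le (a b : bool * bool * bool * bool) : bool :=
  let: (a1, a2, a3, a4) := a in let: (b1, b2, b3, b4) := b in
  [&& a1 ==> b1, a2 ==> b2, a3 ==> b3 & a4 ==> b4].

Definition all_bits : seq (bool * bool * bool * bool) :=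
  map bits_of_labels (flatten B4_lists).

Lemma mem_all_bits a : a \in all_bits.
Proof. by case: a => -[[[] []] []] []. Qed.

Lemma bits_set_of_labels c : bits (set_of_labels c) = bits_of_labels c.
Proof. by rewrite /bits /set_of_labels !inE !inordK. Qed.

Lemma subset_bits (A B : boolean_lattice 4) :
  (A <= B)%O = bits_le (bits A) (bits B).
Proof.
rewrite le_boolean_lattice; apply/subsetP/and4P=> [sub|[h0 h1 h2 h3] i].
  by split; apply/implyP/sub.
rewrite -[i]inord_val; move: h0 h1 h2 h3.
by case: i => [[|[|[|[|]]]]] //= _ /implyP h0 /implyP h1 /implyP h2 /implyP.
Qed.

Lemma bits_inj : injective bits.
Proof.
move=> A B eq_AB; apply: le_anti; rewrite !subset_bits eq_AB.
by case: (bits B) => -[[[] []] []] [].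
Qed.

(** Through the injection [bits], the three clauses become closed boolean
    statements about the sixteen quadruples. *)
Lemma list_realizer_B4 : list_realizer 3 (map (map set_of_labels) B4_lists).
Proof.
have bitsK s : map bits (map set_of_labels s) = map bits_of_labels s.
  by rewrite -map_comp; apply: eq_map => c; apply: bits_set_of_labels.
have memE s A :
    (A \in map set_of_labels s) = (bits A \in map bits_of_labels s).
  by rewrite -bitsK mem_map //; apply: bits_inj.
have indexE s A :
    index A (map set_of_labels s) = index (bits A) (map bits_of_labels s).
  by rewrite -bitsK index_map //; apply: bits_inj.
split.
- have check : all (fun s => all (fun a => all (fun b =>
      [==> a \in s, b \in s, bits_le a b => index a s <= index b s])
      all_bits) all_bits) (map (map bits_of_labels) B4_lists).
    by vm_compute.
  move=> _ /mapP[s sB4 ->] A B; rewrite !memE !indexE subset_bits => As Bs AB.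
  have /allP/(_ _ (mem_all_bits (bits A)))/allP := allP check _ (map_f _ sB4).
  by move/(_ _ (mem_all_bits (bits B))); rewrite As Bs AB.
- have check : all (fun a => all (fun b =>
      ~~ (bits_le a b && ~~ bits_le b a) ==>
      has (fun s => [&& b \in s, a \in s & index b s <= index a s])
        (map (map bits_of_labels) B4_lists)) all_bits) all_bits.
    by vm_compute.
  move=> A B; rewrite lt_leAnge !subset_bits => nltAB.
  have /allP := allP check _ (mem_all_bits (bits A)).
  move=> /(_ _ (mem_all_bits (bits B))); rewrite nltAB !has_map.
  by apply: sub_has => s; rewrite /= /precedes !memE !indexE.
- move=> A; rewrite count_map.
  rewrite (eq_count (a2 := fun s => bits A \in map bits_of_labels s)).
    by case: (bits A) => -[[[] []] []] [].
  by move=> s; rewrite /= memE.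
Qed.

(** * The bound *)

Theorem theorem1 (n : nat) (hn : (4 <= n)%N) : (ldim (boolean_lattice n) < n)%N.
Proof.
suff /(_ (n - 4))[ls real] m : exists ls : seq (seq (boolean_lattice (m + 4))),
     list_realizer (m + 3) ls.
  by rewrite -(subnK hn); apply: leq_ltn_trans (ldim_list_realizer real) _; lia.
elim: m => [|m [ls real]]; last exact: list_realizer_boolean_latticeS real.
by exists (map (map set_of_labels) B4_lists); apply: list_realizer_B4.
Qed.
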